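(* Let $P$ be a connected finite $T_0$ space with order complex $\mathcal{K}(P)$. Then $\mathcal{CC}^{\infty}_n(P) = SC_n(\mathcal{K}(P))$ for every integer $n\geq 2$.
   Context: **Finite spaces.** A finite space is a finite $T_0$ topological space; all finite spaces are assumed connected. A finite space $P$ is identified with a finite poset: $x\le y$ iff $U_x\subseteq U_y$, where $U_x$ is the intersection of all open sets containing $x$; conversely $U_x=\{y: y\le x\}$, so open sets are the down-closed sets. Continuous maps between finite spaces are exactly order-preserving maps. $P^n$ has the product (coordinatewise) order. The order complex $\mathcal{K}(P)$ is the simplicial complex whose simplices are the nonempty linearly ordered subsets (chains) of $P$. The barycentric subdivision $\mathrm{sd}(P)$ of $P$ is the poset of simplices of $\mathcal{K}(P)$ ordered by inclusion, and $\tau_P:\mathrm{sd}(P)\to P$ sends a chain $p_0\le\cdots\le p_l$ to its last element $p_l$. $\mathrm{sd}^{k}$ is the iterated subdivision ($\mathrm{sd}^0(P)=P$), and $\tau^k_P:\mathrm{sd}^k(P)\to P$ is the composition $\tau_P\circ\tau_{\mathrm{sd}(P)}\circ\cdots\circ\tau_{\mathrm{sd}^{k-1}(P)}$ (the identity for $k=0$). **Higher combinatorial complexity with subdivision.** For $n\ge2$, $m\ge0$, $J_{n,m}$ is the poset on the $nm+1$ points $\{0\}\cup\{i_j : 1\le i\le m,\ 1\le j\le n\}$ with order given by the $n$ zigzags $0\le 1_j\ge 2_j\le\cdots\ge(\le)\, m_j$, $j=1,\dots,n$. $P^{J_{n,m}}$ is the finite space of all order-preserving maps $J_{n,m}\to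 P$ with pointwise order, and $q_{n,m}:P^{J_{n,m}}\to P^n$, $q_{n,m}(\gamma)=(\gamma(m_1),\dots,\gamma(m_n))$. For $k\ge0$, $\mathcal{CC}^k_n(P)$ is the smallest nonnegative integer $r$ such that there exist an open cover $\{Q_i\}_{i=1}^r$ of $\mathrm{sd}^k(P^n)$, a positive integer $m$, and continuous maps $s_i:Q_i\to P^{J_{n,m}}$ with $q_{n,m}\circ s_i=\tau^k_{P^n}$ on $Q_i$ for each $i$ ($\infty$ if there is no such $r$). $\mathcal{CC}^\infty_n(P)=\min_{k\ge0}\mathcal{CC}^k_n(P)$. **Contiguity.** Simplicial maps $\phi,\phi' : K\to L$ are in the same contiguity class if there are a positive integer $c$ and simplicial maps $\phi=\phi_0,\phi_1,\dots,\phi_c=\phi' : K\to L$ such that $\phi_{i-1}(\sigma)\cup\phi_i(\sigma)$ is a simplex of $L$ for each simplex $\sigma$ of $K$ and each $i\in\{1,\dots,c\}$. **Higher simplicial complexity.** Let $K$ be a simplicial complex with a fixed partial order on its vertices that is total on each simplex (for $K=\mathcal{K}(P)$, the order of $P$). $K^n$ is the ordered product: its vertices are $n$-tuples of vertices of $K$, and a finite nonempty set of tuples is a simplex if it is a chain for the coordinatewise order and each of its $n$ coordinate projections is a simplex of $K$; thus $\mathcal{K}(P)^n=\mathcal{K}(P^n)$. $\mathrm{sd}$ is barycentric subdivision of complexes, $\mathrm{sd}^{k+1}=\mathrm{sd}\circ\mathrm{sd}^k$. For each $k \ge 1$ choose a simplicial approximation $\mathrm{sd}^k(K^n)\to \mathrm{sd}^{k-1}(K^n)$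 of the identity; let $\iota^k_{K^n} : \mathrm{sd}^k(K^n)\to K^n$ be the iterated composition, and let $\pi_j : \mathrm{sd}^k(K^n)\to K$ be $\iota^k_{K^n}$ followed by the $j$-th projection, $j=1,\dots,n$. $SC^k_n(K)$ is the smallest nonnegative integer $r$ such that there are subcomplexes $L_1,\dots,L_r$ covering $\mathrm{sd}^k(K^n)$ such that for each $i$ the restrictions $\pi_1,\dots,\pi_n : L_i\to K$ lie in the same contiguity class ($\infty$ if there is no such $r$); this is independent of the chosen approximations. $SC_n(K)=\min_{k\ge0} SC^k_n(K)$. *)

(* Defs.v *)
From HB Require Import structures.
From mathcomp Require Import all_boot all_order all_algebra.
From mathcomp Require Import boolp reals.

Set Implicit Arguments.
Unset Strict Implicit.
Unset Printing Implicit Defensive.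

Import Order.TTheory GRing.Theory Num.Theory.

(* None is infinity. *)
Definition enat := option nat.

Definition least (A : nat -> Prop) : enat :=
  if pselect (exists r, `[< A r >]) is left h then Some (ex_minn h) else None.

Definition emin (f : nat -> enat) : enat :=
  least (fun r => exists k, f k = Some r).

(* A finite T0 space is a finPOrderType; its open sets are the down-closed
   sets. *)
Section FiniteSpaces.
Context {d : Order.disp_t} {P : finPOrderType d}.

Definition fs_open (A : {set P}) : Prop :=
  forall x y : P, (y <= x)%O -> x \in A -> y \in A.

Definition fs_connected : Prop :=
  forall A B : {set P}, fs_open A -> fs_open B ->
    A :|: B = setT -> A :&: B = set0 -> A = set0 \/ B = set0.

End FiniteSpaces.
Arguments fs_connected {d} P.

(* The values of f outside Q are irrelevant.  This is continuity for the
   subspace topology when Q is open, the only case in which it is used. *)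
Definition fs_continuous_on {d d'} {P : finPOrderType d}
    {P' : finPOrderType d'} (Q : {set P}) (f : P -> P') : Prop :=
  forall V : {set P'}, fs_open V -> fs_open (Q :&: f @^-1: V).

Lemma fs_continuous_onP {d d'} {P : finPOrderType d} {P' : finPOrderType d'}
    (Q : {set P}) (f : P -> P') : fs_open Q ->
  fs_continuous_on Q f <-> {in Q &, {homo f : x y / (x <= y)%O}}.
Proof.
move=> oQ; split=> [cf x y xQ yQ xy | mf V oV x y yx].
  have oV : fs_open [set z | (z <= f y)%O].
    by move=> u v vu; rewrite !inE; apply: le_trans.
  by have := cf _ oV y x xy; rewrite !inE yQ lexx => /(_ isT) /andP[].
rewrite !inE => /andP[xQ fxV]; have yQ := oQ _ _ yx xQ.
by rewrite yQ; apply: oV (mf _ _ yQ xQ yx) fxV.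
Qed.

Definition fpow (I : finType) {d} (P : finPOrderType d) := {ffun I -> P}.

Section PointwiseOrder.
Context (I : finType) {d : Order.disp_t} (P : finPOrderType d).

HB.instance Definition _ := Finite.on (fpow I P).

Definition fpow_le (f g : fpow I P) := [forall i, (f i <= g i)%O].

Fact fpow_le_refl : reflexive fpow_le.
Proof. by move=> f; apply/forallP. Qed.

Fact fpow_le_anti : antisymmetric fpow_le.
Proof.
move=> f g /andP[/forallP fg /forallP gf].
by apply/ffunP => i; apply: le_anti; rewrite fg gf.
Qed.

Fact fpow_le_trans : transitive fpow_le.
Proof.
move=> g f h /forallP fg /forallP gh.
by apply/forallP => i; apply: le_trans (gh i).
Qed.

HB.instance Definition _ := Order.Le_isPOrder.Build d (fpow I P)
  fpow_le_refl fpow_le_anti fpow_le_trans.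

End PointwiseOrder.

Definition power (n : nat) {d} (P : finPOrderType d) : finPOrderType d :=
  fpow 'I_n P.

Section MappingSpace.
Context {dJ d : Order.disp_t} (J : finPOrderType dJ) (P : finPOrderType d).

Definition monotone (f : fpow J P) : bool :=
  [forall x, forall y, (x <= y)%O ==> (f x <= f y)%O].

Record mspace := MSpace { mspace_fun :> fpow J P; _ : monotone mspace_fun }.

HB.instance Definition _ := [isSub for mspace_fun].
HB.instance Definition _ := [Finite of mspace by <:].
HB.instance Definition _ := [SubChoice_isSubPOrder of mspace by <: with d].

End MappingSpace.

(* The vertices of a complex are the v with [set v] a face; elements of the
   ground type V need not all be vertices, so that a subcomplex lives on the
   same ground type. *)
Record complex (V : finType) := Complex {
  faces : {set {set V}};
  faces_neq0 : set0 \notin faces;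
  faces_sub : forall s t : {set V},
    s \in faces -> t \subset s -> t != set0 -> t \in faces
}.

Definition vertices (V : finType) (K : complex V) : {set V} :=
  [set v | [set v] \in faces K].

Definition subcomplex (V : finType) (L K : complex V) : bool :=
  faces L \subset faces K.

Record scomplex := SComplex { ground : finType; cplx :> complex ground }.

Definition is_chain {d} {P : finPOrderType d} (A : {set P}) : bool :=
  [forall x in A, forall y in A, (x <= y)%O || (y <= x)%O].

Lemma is_chainP {d} {P : finPOrderType d} (A : {set P}) :
  reflect {in A &, forall x y, (x <= y)%O || (y <= x)%O} (is_chain A).
Proof.
apply: (iffP forall_inP) => [h x y xA yA | h x xA].
  by move/forall_inP: (h x xA); apply.
by apply/forall_inP => y; apply: h.
Qed.

Section OrderComplex.
Context {d : Order.disp_t} (P : finPOrderType d).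

Definition chains : {set {set P}} := [set A : {set P} | (A != set0) && is_chain A].

Fact chains_neq0 : set0 \notin chains.
Proof. by rewrite inE eqxx. Qed.

Fact chains_sub (s t : {set P}) :
  s \in chains -> t \subset s -> t != set0 -> t \in chains.
Proof.
rewrite !inE => /andP[_ /is_chainP cs] /subsetP ts ->.
by apply/is_chainP => x y /ts xs /ts; apply: cs.
Qed.

Definition order_complex : complex P := Complex chains_neq0 chains_sub.

End OrderComplex.

Fact face_display : Order.disp_t. Proof. exact: Order.Disp tt tt. Qed.

Section FacePoset.
Context {V : finType} (K : complex V).

Record simplex := Simplex { simplex_set :> {set V}; _ : simplex_set \in faces K }.

HB.instance Definition _ := [isSub for simplex_set].
HB.instance Definition _ := [Finite of simplex by <:].

Definition simplex_le (s t : simplex) := val s \subset val t.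

Fact simplex_le_refl : reflexive simplex_le.
Proof. by move=> s; apply: subxx. Qed.

Fact simplex_le_anti : antisymmetric simplex_le.
Proof. by move=> s t h; apply/val_inj/eqP; rewrite eqEsubset. Qed.

Fact simplex_le_trans : transitive simplex_le.
Proof. by move=> t s u; apply: subset_trans. Qed.

HB.instance Definition _ := Order.Le_isPOrder.Build face_display simplex
  simplex_le_refl simplex_le_anti simplex_le_trans.

Definition face_poset : finPOrderType face_display := simplex.

End FacePoset.

Definition sd {d} (P : finPOrderType d) : finPOrderType face_display :=
  face_poset (order_complex P).

Fact chain_last {d} (P : finPOrderType d) (s : sd P) :
  exists p, (p \in val s) && [forall x in val s, (x <= p)%O].
Proof.
case: s => A /=; rewrite inE => /andP[/set0Pn[a aA] /is_chainP cA].
have [p pA pmax] := @arg_maxnP _ a (mem A) (fun p => #|[set x in A | (x <= p)%O]|) aA.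
exists p; apply/andP; split=> //; apply/forall_inP => x xA.
have /orP[//|px] := cA x p xA pA; have := pmax x xA.
move=> le_xp; have sub : [set z in A | (z <= p)%O] \subset [set z in A | (z <= x)%O].
  by apply/subsetP => z; rewrite !inE => /andP[-> /= zp]; apply: le_trans px.
have /eqP eq : [set z in A | (z <= p)%O] == [set z in A | (z <= x)%O].
  by rewrite eqEcard sub.
by have := in_set (fun z => (z \in A) && (z <= x)%O) x; rewrite -eq !inE xA lexx.
Qed.

Definition tau {d} (P : finPOrderType d) (s : sd P) : P := xchoose (chain_last s).

Definition sd_disp (d : Order.disp_t) (k : nat) : Order.disp_t :=
  if k is 0 then d else face_display.

Fixpoint sdk {d} (k : nat) (P : finPOrderType d) : finPOrderType (sd_disp d k) :=
  match k return finPOrderType (sd_disp d k) with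
  | 0 => P
  | k'.+1 => sd (sdk k' P)
  end.

Fixpoint tauk {d} (k : nat) (P : finPOrderType d) : sdk k P -> P :=
  match k return sdk k P -> P with
  | 0 => id
  | k'.+1 => @tauk d k' P \o @tau _ (sdk k' P)
  end.

(* None is the point 0 and Some (i, j) is the point (i+1)_j. *)
Definition fan (n m : nat) : Type := option ('I_m * 'I_n).

Fact fan_display : Order.disp_t. Proof. exact: Order.Disp tt tt. Qed.

Section Fan.
Context (n m : nat).

HB.instance Definition _ := Finite.on (fan n m).

Definition fan_level (x : fan n m) : nat :=
  if x is Some (i, _) then i.+1 else 0.

Definition same_leg (x y : fan n m) : bool :=
  match x, y with
  | Some (_, j), Some (_, j') => j == j'
  | _, _ => true
  end.

Definition fan_le (x y : fan n m) : bool :=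
  (x == y) ||
  [&& same_leg x y, ~~ odd (fan_level x), odd (fan_level y) &
      (fan_level x == (fan_level y).+1) || (fan_level y == (fan_level x).+1)].

Fact fan_le_refl : reflexive fan_le.
Proof. by move=> x; rewrite /fan_le eqxx. Qed.

Fact fan_le_anti : antisymmetric fan_le.
Proof.
move=> x y /andP[/orP[/eqP// | /and4P[_ /negPf ex _ _]]].
by case/orP=> [/eqP// | /and4P[_ _ ox _]]; rewrite ox in ex.
Qed.

Fact fan_le_trans : transitive fan_le.
Proof.
move=> y x z /orP[/eqP-> // | h] /orP[/eqP<- | /and4P[_ /negPf ey _ _]].
  by rewrite /fan_le h orbT.
by case/and4P: h => _ _ oy _; rewrite oy in ey.
Qed.

HB.instance Definition _ := Order.Le_isPOrder.Build fan_display (fan n m)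
  fan_le_refl fan_le_anti fan_le_trans.

End Fan.

Definition fan_end (n m : nat) (j : 'I_n) : fan n m :=
  match m return fan n m with
  | 0 => None
  | m'.+1 => Some (ord_max, j)
  end.

Definition fan_poset (n m : nat) : finPOrderType _ := fan n m.

Definition path_space (n m : nat) {d} (P : finPOrderType d) : finPOrderType d :=
  mspace (fan_poset n m) P.

Definition endpoints (n m : nat) {d} (P : finPOrderType d) (g : path_space n m P) :
    power n P :=
  [ffun j => mspace_fun g (fan_end m j)].

Definition CC_cover (n k : nat) {d} (P : finPOrderType d) (r : nat) : Prop :=
  exists Q : 'I_r -> {set sdk k (power n P)},
    [/\ forall i, fs_open (Q i),
        \bigcup_i Q i = setT
      & exists2 m : nat, (0 < m)%N &
        exists s : 'I_r -> sdk k (power n P) -> path_space n m P,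
          forall i, fs_continuous_on (Q i) (s i) /\
                    {in Q i, forall x, endpoints (s i x) = tauk x}].

Definition CC (n k : nat) {d} (P : finPOrderType d) : enat :=
  least (CC_cover n k P).

Definition CC_infty (n : nat) {d} (P : finPOrderType d) : enat :=
  emin (fun k => CC n k P).

(* Maps out of a complex are functions on its ground type; only their values
   at vertices matter. *)
Definition simplicial (V W : finType) (K : complex V) (L : complex W)
    (f : V -> W) : Prop :=
  forall s : {set V}, s \in faces K -> f @: s \in faces L.

Definition contiguous (V W : finType) (K : complex V) (L : complex W)
    (f g : V -> W) : Prop :=
  forall s : {set V}, s \in faces K -> f @: s :|: g @: s \in faces L.

Definition contiguity_class (V W : finType) (K : complex V) (L : complex W)
    (f g : V -> W) : Prop :=
  exists2 c : nat, (0 < c)%N &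
  exists phi : nat -> V -> W,
    [/\ forall i, (i <= c)%N -> simplicial K L (phi i),
        {in vertices K, phi 0 =1 f},
        {in vertices K, phi c =1 g}
      & forall i, (i < c)%N -> contiguous K L (phi i) (phi i.+1)].

Definition sd_complex (V : finType) (K : complex V) : scomplex :=
  SComplex (order_complex (face_poset K)).

Fixpoint sdk_complex (k : nat) (V : finType) (K : complex V) : scomplex :=
  if k is k'.+1 then sd_complex (sdk_complex k' K) else SComplex K.

Section Realization.
Local Open Scope ring_scope.
Context {R : realType}.

Definition support_of (V : finType) (x : {ffun V -> R}) : {set V} :=
  [set v | x v != 0].

(* Points of |K|, in barycentric coordinates. *)
Definition realization (V : finType) (K : complex V) (x : {ffun V -> R}) : Prop :=
  [/\ forall v, 0 <= x v, \sum_v x v = 1 & support_of x \in faces K].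

Definition realize_map (V W : finType) (f : V -> W) (x : {ffun V -> R}) :
    {ffun W -> R} :=
  [ffun w => \sum_(v | f v == w) x v].

(* |f| x lies in the closed simplex of |L| whose interior contains h x. *)
Definition simplicial_approximation (V W : finType) (K : complex V)
    (L : complex W) (h : {ffun V -> R} -> {ffun W -> R}) (f : V -> W) : Prop :=
  simplicial K L f /\
  forall x, realization K x -> support_of (realize_map f x) \subset support_of (h x).

(* The identification |sd K| = |K|, affine on simplices and sending the vertex
   s of sd K to the barycenter of s. *)
Definition sd_realization (V : finType) (K : complex V)
    (x : {ffun ground (sd_complex K) -> R}) : {ffun V -> R} :=
  [ffun v => \sum_(s : simplex K | v \in val s) x s / #|val s|%:R].

End Realization.

(* a k is the chosen map sd^(k+1) K -> sd^k K. *)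
Definition approx_family (V : finType) (K : complex V) : Type :=
  forall k : nat, ground (sdk_complex k.+1 K) -> ground (sdk_complex k K).

Definition approximates_id (R : realType) (V : finType) (K : complex V)
    (a : approx_family K) : Prop :=
  forall k : nat,
    simplicial_approximation (R := R) (sdk_complex k.+1 K) (sdk_complex k K)
      (@sd_realization R _ (sdk_complex k K)) (a k).

Fixpoint iotak (V : finType) (K : complex V) (a : approx_family K) (k : nat) :
    ground (sdk_complex k K) -> V :=
  match k return ground (sdk_complex k K) -> V with
  | 0 => id
  | k'.+1 => @iotak V K a k' \o a k'
  end.

Record ocomplex {d} (V : finPOrderType d) := OComplex {
  ocplx :> complex V;
  ocplx_total : forall s : {set V}, s \in faces ocplx -> is_chain s
}.

Fact order_complex_total {d} (P : finPOrderType d) (s : {set P}) :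
  s \in faces (order_complex P) -> is_chain s.
Proof. by rewrite inE => /andP[]. Qed.

Definition ordered_order_complex {d} (P : finPOrderType d) : ocomplex P :=
  OComplex (@order_complex_total d P).

Section OrderedProduct.
Context {d : Order.disp_t} {V : finPOrderType d} (K : ocomplex V) (n : nat).

Definition prod_faces : {set {set power n V}} :=
  [set A : {set power n V} | [&& A != set0, is_chain A &
    [forall j : 'I_n, [set fun_of_fin x j | x : power n V in A] \in faces K]]].

Fact prod_faces_neq0 : set0 \notin prod_faces.
Proof. by rewrite inE eqxx. Qed.

Fact prod_faces_sub (s t : {set power n V}) :
  s \in prod_faces -> t \subset s -> t != set0 -> t \in prod_faces.
Proof.
rewrite !inE => /and3P[_ /is_chainP cs /forallP fs] ts t0.
rewrite t0 /=; apply/andP; split.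
  by apply/is_chainP => x y /(subsetP ts) xs /(subsetP ts); apply: cs.
apply/forallP => j; apply: faces_sub (fs j) (imsetS _ ts) _.
have [x xt] := set0Pn _ t0.
by apply/set0Pn; exists (fun_of_fin x j); apply: imset_f.
Qed.

Definition ordered_product : complex (power n V) :=
  Complex prod_faces_neq0 prod_faces_sub.

Context (a : approx_family ordered_product).

Definition proj_map (k : nat) (j : 'I_n)
    (x : ground (sdk_complex k ordered_product)) : V :=
  fun_of_fin (iotak a x : power n V) j.

Definition SC_cover (k r : nat) : Prop :=
  exists L : 'I_r -> complex (ground (sdk_complex k ordered_product)),
    [/\ forall i, subcomplex (L i) (sdk_complex k ordered_product),
        \bigcup_i faces (L i) = faces (sdk_complex k ordered_product)
      & forall i (j j' : 'I_n),
          contiguity_class (L i) K (@proj_map k j) (@proj_map k j')].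

Definition SCk (k : nat) : enat := least (SC_cover k).

Definition SC : enat := emin SCk.

End OrderedProduct.

(* Main.v *)
Require Import Defs.
From mathcomp Require Import all_boot all_order all_algebra.
From mathcomp Require Import boolp reals.

(* Since K(P)^n = K(P^n), the iterated subdivision sd^k(K(P)^n) is the order
   complex of sd^k(P^n).  A simplicial approximation of the identity sends a
   barycenter s to a vertex of s, as tau does, so iota^k and tau^k are in the same
   contiguity class and iota^k may be replaced by tau^k.  Given an open cover (Q_i)
   with motion planners, the complexes of chains in Q_i form a cover, and a fence
   of monotone maps on Q_i yields a sequence of contiguities.  Conversely,
   subcomplexes L_i of K(sd^k(P^n)) are down-sets of sd^(k+1)(P^n), and contiguous
   maps phi, psi on L_i yield the fence
   max phi(s) <= max (phi(s) U psi(s)) >= max psi(s) of monotone maps. *)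

Set Implicit Arguments.
Unset Strict Implicit.
Unset Printing Implicit Defensive.

Import Order.TTheory GRing.Theory Num.Theory.

(** * Least values in the extended naturals *)

Lemma leastP (A : nat -> Prop) :
  if least A is Some r then A r /\ forall r', A r' -> (r <= r')%N
  else forall r, ~ A r.
Proof.
rewrite /least; case: pselect => [h | nh].
  by case: ex_minnP => r /asboolP Ar rmin; split=> // r' /asboolP; apply: rmin.
by move=> r Ar; apply: nh; exists r; apply/asboolP.
Qed.

Lemma leastE (A : nat -> Prop) r :
  A r -> (forall r', A r' -> (r <= r')%N) -> least A = Some r.
Proof.
move=> Ar rmin; have := leastP A; case: (least A) => [r0 [Ar0 r0min] | /(_ r) //].
by congr Some; apply/eqP; rewrite eqn_leq r0min ?rmin.
Qed.

(** Reduces an equality of two such minima to comparing the sizes [r] attained at some level, where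
    the levels on the two sides may differ. *)
Lemma emin_least (A : nat -> nat -> Prop) :
  emin (fun k => least (A k)) = least (fun r => exists k, A k r).
Proof.
have leastA k r : least (A k) = Some r -> A k r.
  by move=> E; have := leastP (A k); rewrite E => -[].
rewrite /emin; have := leastP (fun r => exists k, A k r).
case: (least (fun r => exists k, A k r)) => [r [[k Akr] rmin] | nA].
  apply: leastE => [|r' [k' /leastA Ak'r']]; last by apply: rmin; exists k'.
  by exists k; apply: leastE => // r' Akr'; apply: rmin; exists k.
have := leastP (fun r => exists k, least (A k) = Some r).
by case: least => // r [[k /leastA Akr]] _; case: (nA r); exists k.
Qed.

(** * Faces and contiguity classes *)

Lemma complex_inj (V : finType) (K L : complex V) : faces K = faces L -> K = L.
Proof.
case: K L => [F F0 FS] [G G0 GS] /= E; case: _ / E in G0 GS *.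
by congr Complex; apply: Prop_irrelevance.
Qed.

Lemma face_vertex (V : finType) (K : complex V) (s : {set V}) (v : V) :
  s \in faces K -> v \in s -> v \in vertices K.
Proof.
move=> sK vs; rewrite inE; apply: (faces_sub sK); first by rewrite sub1set.
by apply/set0Pn; exists v; rewrite set11.
Qed.

Lemma face_neq0 (V : finType) (K : complex V) (s : {set V}) :
  s \in faces K -> s != set0.
Proof. by move=> sK; apply: contraTneq sK => ->; apply: faces_neq0. Qed.

Lemma imset_neq0 (V W : finType) (f : V -> W) (s : {set V}) :
  s != set0 -> f @: s != set0.
Proof. by case/set0Pn=> v vs; apply/set0Pn; exists (f v); apply: imset_f. Qed.

Section Contiguity.
Context {V W : finType}.
Implicit Types (K : complex V) (L : complex W) (f g : V -> W).

Lemma eq_imset_face K f g (s : {set V}) :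
  {in vertices K, f =1 g} -> s \in faces K -> f @: s = g @: s.
Proof. by move=> fg sK; apply: eq_in_imset => v /(face_vertex sK); apply: fg. Qed.

Lemma simplicial_vertex K L f v :
  simplicial K L f -> v \in vertices K -> f v \in vertices L.
Proof. by move=> fKL; rewrite !inE -imset_set1; apply: fKL. Qed.

Lemma contiguous_sym K L f g : contiguous K L f g -> contiguous K L g f.
Proof. by move=> fg s /fg; rewrite setUC. Qed.

Lemma contiguous_simplicial K L f g : contiguous K L f g -> simplicial K L f.
Proof.
move=> fg s sK; apply: faces_sub (fg s sK) (subsetUl _ _) _.
exact/imset_neq0/(face_neq0 sK).
Qed.

Lemma contiguous_refl K L f : simplicial K L f -> contiguous K L f f.
Proof. by move=> fKL s sK; rewrite setUid; apply: fKL. Qed.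

Lemma contiguous_class K L f g : contiguous K L f g -> contiguity_class K L f g.
Proof.
move=> fg; exists 1%N => //; exists (fun i => if i is 0 then f else g).
split=> // [[|i] _ | [|//] _] //; first exact: contiguous_simplicial fg.
exact: contiguous_simplicial (contiguous_sym fg).
Qed.

Lemma contiguity_class_sym K L f g :
  contiguity_class K L f g -> contiguity_class K L g f.
Proof.
case=> c c0 [phi [sphi phi0 phic cphi]]; exists c => //.
exists (fun i => phi (c - i)%N); split=> [i _||| i ic].
- by apply: sphi; rewrite leq_subr.
- by rewrite subn0.
- by rewrite subnn.
by apply: contiguous_sym; rewrite -(subnSK ic); apply: cphi; rewrite subnSK ?leq_subr.
Qed.

Lemma contiguity_class_trans K L f g h :
  contiguity_class K L f g -> contiguity_class K L g h -> contiguity_class K L f h.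
Proof.
move=> [c c0 [phi [sphi phi0 phic cphi]]] [e e0 [psi [spsi psi0 psie cpsi]]].
exists (c + e)%N; first by rewrite addn_gt0 c0.
exists (fun i => if (i <= c)%N then phi i else psi (i - c)%N).
split=> [i ile||| i ilt].
- by case: leqP => ic; [apply: sphi | apply: spsi; rewrite leq_subLR].
- by rewrite leq0n.
- by rewrite leqNgt -[X in (X < _)%N]addn0 ltn_add2l e0 /= addKn.
case: (ltngtP i c) => ic; first exact: cphi.
  by rewrite subSn 1?ltnW //; apply: cpsi; rewrite ltn_subLR // ltnW.
(* At the junction the sequence passes from [phi c] to [psi 1]; since [phi c] and [psi 0] both agree
   with [g] on vertices, the first contiguity of [psi] applies. *)
rewrite ic subSnn => s sK; have phipsi : {in vertices K, phi c =1 psi 0%N}.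
  by move=> v vK; rewrite phic ?psi0.
by rewrite (eq_imset_face phipsi sK); apply: cpsi.
Qed.

(** Repeating the last map makes the sequence infinite, so that one common length can later serve
    all members of a cover and all coordinates. *)
Lemma contiguity_class_pad K L f g c :
  (exists phi : nat -> V -> W,
    [/\ forall i, (i <= c)%N -> simplicial K L (phi i),
        {in vertices K, phi 0 =1 f},
        {in vertices K, phi c =1 g}
      & forall i, (i < c)%N -> contiguous K L (phi i) (phi i.+1)]) ->
  exists phi : nat -> V -> W,
    [/\ {in vertices K, phi 0 =1 f},
        forall c', (c <= c')%N -> {in vertices K, phi c' =1 g}
      & forall i, contiguous K L (phi i) (phi i.+1)].
Proof.
case=> phi [sphi phi0 phic cphi]; exists (fun i => phi (minn i c)).
split=> [|c' /minn_idPr->//|i]; first by rewrite min0n.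
have [ic|ci] := ltnP i c.
  by rewrite (minn_idPl ic); apply: cphi.
rewrite (minn_idPr (leqW ci)).
exact/contiguous_refl/sphi.
Qed.

Lemma contiguity_class_sub K K' L f g : subcomplex K' K ->
  contiguity_class K L f g -> contiguity_class K' L f g.
Proof.
move=> /subsetP K'K [c c0 [phi [sphi phi0 phic cphi]]]; exists c => //.
have vK'K v : v \in vertices K' -> v \in vertices K by rewrite !inE => /K'K.
exists phi; split=> [i ic s /K'K|v /vK'K|v /vK'K|i ic s /K'K].
- exact: sphi.
- exact: phi0.
- exact: phic.
- exact: cphi.
Qed.

End Contiguity.

(** The two sequences are run one after the other, through [psi 0 \o f']: first the inner map moves,
    then the outer one. *)
Lemma contiguity_class_comp (U V W : finType) (K : complex U) (L : complex V)
    (M : complex W) (f f' : U -> V) (g g' : V -> W) :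
  contiguity_class K L f f' -> contiguity_class L M g g' ->
  contiguity_class K M (g \o f) (g' \o f').
Proof.
move=> [c c0 [phi [sphi phi0 phic cphi]]] [e e0 [psi [spsi psi0 psie cpsi]]].
apply: (@contiguity_class_trans _ _ _ _ _ (psi 0%N \o f')).
  exists c => //; exists (fun i => psi 0%N \o phi i); split.
  - by move=> i ic s sK; rewrite imset_comp; apply/spsi => //; apply: sphi.
  - move=> v vK /=; rewrite -phi0 // psi0 //.
    exact: simplicial_vertex (sphi 0%N isT) vK.
  - by move=> v vK /=; rewrite phic.
  - move=> i ic s sK; rewrite (imset_comp _ (phi i)) (imset_comp _ (phi i.+1)) -imsetU.
    by apply/spsi => //; apply: cphi.
have vf' v : v \in vertices K -> f' v \in vertices L.
  by move=> vK; rewrite -phic //; apply: simplicial_vertex vK; apply: sphi.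
have sf' s : s \in faces K -> f' @: s \in faces L.
  by move=> sK; rewrite -(eq_imset_face phic sK); apply: sphi.
exists e => //; exists (fun i => psi i \o f'); split=> [i ie s|//|v vK /=|i ie s].
- by rewrite imset_comp => /sf'; apply: spsi.
- by rewrite psie ?vf'.
- by rewrite (imset_comp (psi i)) (imset_comp (psi i.+1)) => /sf'; apply: cpsi.
Qed.

(** * Monotone maps and contiguity *)

Section MonotoneMaps.
Context {d d' : Order.disp_t} {Y : finPOrderType d} {Z : finPOrderType d'}.

Definition chains_in (Q : {set Y}) : {set {set Y}} :=
  [set A in chains Y | A \subset Q].

Fact chains_in_neq0 (Q : {set Y}) : set0 \notin chains_in Q.
Proof. by rewrite inE negb_and chains_neq0. Qed.

Fact chains_in_sub (Q s t : {set Y}) :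
  s \in chains_in Q -> t \subset s -> t != set0 -> t \in chains_in Q.
Proof.
rewrite [s \in _]inE [t \in _]inE => /andP[cs sQ] ts t0.
by rewrite (chains_sub cs) // (subset_trans ts).
Qed.

Definition chain_complex (Q : {set Y}) : complex Y :=
  Complex (@chains_in_neq0 Q) (@chains_in_sub Q).

Lemma homo_simplicial (f : Y -> Z) : {homo f : x y / (x <= y)%O} ->
  simplicial (order_complex Y) (order_complex Z) f.
Proof.
move=> mf s; rewrite !inE => /andP[s0 /is_chainP cs]; rewrite imset_neq0 //=.
apply/is_chainP => _ _ /imsetP[x xs ->] /imsetP[y ys ->].
by have /orP[/mf-> | /mf->] := cs x y xs ys; rewrite ?orbT.
Qed.

(* Comparable monotone maps need not be contiguous, so we switch from f to g
   one rank at a time: a chain meets each rank at most once. *)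
Lemma le_contiguity_class (Q : {set Y}) (f g : Y -> Z) :
  {in Q &, {homo f : x y / (x <= y)%O}} ->
  {in Q &, {homo g : x y / (x <= y)%O}} ->
  {in Q, forall x, (f x <= g x)%O} ->
  contiguity_class (chain_complex Q) (order_complex Z) f g.
Proof.
move=> mf mg fg; apply: contiguity_class_sym.
pose rank (y : Y) := #|[set z | (z <= y)%O]|.
have ltrank x y : (x < y)%O -> (rank x < rank y)%N.
  move=> xy; apply/proper_card/properP; split.
    by apply/subsetP => z; rewrite !inE => /le_trans; apply; apply: ltW.
  by exists y; rewrite !inE ?lexx // lt_geF.
(* [h 0] is [g], and [h l] is [f] once [l] exceeds all ranks; this runs from [g] to [f], hence the
   symmetry above. *)
pose h l y := if (l <= rank y)%N then g y else f y.
(* For [x < y] the only bad case is [g] at [x] with [f] at [y]; it would force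
   [rank y <= l <= rank x], against strict growth of the rank. *)
have cmp l a b x y : (l <= a <= l.+1)%N -> (l <= b <= l.+1)%N -> x \in Q -> y \in Q ->
    (x <= y)%O -> (h a x <= h b y)%O || (h b y <= h a x)%O.
  move=> /andP[la _] /andP[_ bl] xQ yQ; rewrite le_eqVlt /h => /orP[/eqP <- | xy].
    by case: ifP; case: ifP; rewrite ?lexx ?fg ?orbT.
  have [mfxy mgxy] : (f x <= f y)%O /\ (g x <= g y)%O.
    by split; [apply: mf | apply: mg]; rewrite // ltW.
  case: ifPn => ax; case: ifPn => bY; rewrite ?mfxy ?mgxy //.
    case/negP: bY; apply: leq_trans bl _; apply: leq_ltn_trans la _.
    exact: leq_ltn_trans ax (ltrank _ _ xy).
  by rewrite (le_trans mfxy) // fg.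
have ch l : contiguous (chain_complex Q) (order_complex Z) (h l) (h l.+1).
  move=> s; rewrite inE => /andP[]; rewrite !inE => /andP[s0 /is_chainP cs] /subsetP sQ.
  apply/andP; split.
    have [z zs] := set0Pn _ (imset_neq0 (h l) s0).
    by apply/set0Pn; exists z; rewrite inE zs.
  have hP u : u \in h l @: s :|: h l.+1 @: s ->
      exists2 x, x \in s & exists2 a, (l <= a <= l.+1)%N & u = h a x.
    rewrite inE => /orP[] /imsetP[x xs ->]; exists x => //.
      by exists l; rewrite ?leqnn /=.
    by exists l.+1; rewrite ?leqnn ?leqW.
  apply/is_chainP => _ _ /hP[x xs [a al ->]] /hP[y ys [b bl ->]].
  have /orP[xy|yx] := cs x y xs ys; first by apply: (@cmp l); rewrite ?sQ.
  by rewrite orbC; apply: (@cmp l); rewrite ?sQ.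
exists #|Y|.+1 => //; exists h; split=> [i _ | // | y _ | i _].
- exact: contiguous_simplicial (ch i).
- by rewrite /h ltnNge max_card.
- exact: ch.
Qed.

End MonotoneMaps.

(** * Last elements of chains *)

Section LastElement.
Context {d : Order.disp_t} {P : finPOrderType d}.

(** A relation on plain sets, so that images and unions of images of chains need not be packaged as
    simplices. *)
Definition is_last (A : {set P}) (p : P) : Prop :=
  p \in A /\ {in A, forall x, (x <= p)%O}.

Lemma chain_is_last (A : {set P}) :
  A \in faces (order_complex P) -> exists p, is_last A p.
Proof.
by move=> cA; have [p /andP[pA /forall_inP pmax]] := chain_last (Simplex cA); exists p.
Qed.

Lemma is_last_le (A B : {set P}) p q :
  A \subset B -> is_last A p -> is_last B q -> (p <= q)%O.
Proof. by move=> /subsetP AB [pA _] [_ qmax]; apply/qmax/AB. Qed.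

Lemma is_last_uniq (A : {set P}) p q : is_last A p -> is_last A q -> p = q.
Proof. by move=> Ap Aq; apply: le_anti; rewrite !(is_last_le (subxx A)). Qed.

Lemma tau_is_last (s : sd P) : is_last (val s) (tau s).
Proof. by have /andP[sP /forall_inP smax] := xchooseP (chain_last s). Qed.

Lemma tau_homo : {homo @tau d P : s t / (s <= t)%O}.
Proof. by move=> s t st; apply: is_last_le st (tau_is_last s) (tau_is_last t). Qed.

End LastElement.

Lemma tauk_homo {d} {P : finPOrderType d} k :
  {homo @tauk d k P : s t / (s <= t)%O}.
Proof. by elim: k => [//|k IH] s t st; apply: IH; apply: tau_homo. Qed.

Lemma is_last_imset {d d'} {Y : finPOrderType d} {Z : finPOrderType d'}
    (f : Y -> Z) (A : {set Y}) y :
  {homo f : x y / (x <= y)%O} -> is_last A y -> is_last (f @: A) (f y).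
Proof.
move=> mf [yA ymax]; split; first exact: imset_f.
by move=> _ /imsetP[x /ymax/mf ? ->].
Qed.

(** * Approximations of the identity on a barycentric subdivision *)

Section BarycentricMaps.
Local Open Scope ring_scope.

(** The approximation condition is tested at the vertex [s] of the subdivision: it is realized as
    the barycenter of [s], whose coordinates vanish off [s], while [realize_map f] sends it to the
    vertex [f s]. *)
Lemma simplicial_approximation_mem (R : realType) (V : finType) (K : complex V)
    (f : simplex K -> V) :
  simplicial_approximation (R := R) (sd_complex K) K (@sd_realization R V K) f ->
  forall s, f s \in val s.
Proof.
case=> _ fapp s; pose x : {ffun simplex K -> R} := [ffun s' => (s' == s)%:R].
have xE s' : x s' = (s' == s)%:R by rewrite ffunE.
have suppx : support_of x = [set s].
  by apply/setP => s'; rewrite !inE xE pnatr_eq0 eqb0 negbK.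
have real_x : realization (sd_complex K) x.
  split=> [s'||]; first by rewrite xE ler0n.
    rewrite (bigD1 s) //= xE eqxx big1 ?addr0 // => s' /negPf s's.
    by rewrite xE s's.
  rewrite suppx inE; apply/andP; split; first by apply/set0Pn; exists s; rewrite set11.
  by apply/is_chainP => u v /set1P-> /set1P->; rewrite lexx.
have /subsetP/(_ (f s)) := fapp x real_x; rewrite !inE !ffunE.
rewrite (bigD1 s) //= xE eqxx big1 => [|s' /andP[_ /negPf s's]]; last by rewrite xE s's.
rewrite addr0 oner_eq0 => /(_ isT); apply: contraNT => fs.
apply/eqP; rewrite big1 // => s' fs'; rewrite xE.
by case: eqP => [E|_]; [rewrite E (negPf fs) in fs' | rewrite mul0r].
Qed.

End BarycentricMaps.

(** All values on a chain of simplices lie in its largest simplex, which is a face. *)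
Lemma mem_simplex_contiguous {d} {Y : finPOrderType d} (b c : sd Y -> Y) :
  (forall s, b s \in val s) -> (forall s, c s \in val s) ->
  contiguous (order_complex (sd Y)) (order_complex Y) b c.
Proof.
move=> hb hc A cA; have [M [MA Mmax]] := chain_is_last cA.
apply: faces_sub (valP M) _ _; last first.
  apply/set0Pn; exists (b M).
  by apply/setUP; left; apply: imset_f.
have AM s : s \in A -> val s \subset val M by move/Mmax.
by rewrite subUset; apply/andP; split; apply/subsetP => _ /imsetP[s sA ->];
  apply: (subsetP (AM s sA)).
Qed.

(** * Comparing the iterated approximation with the iterated last-element map *)

Section IteratedSubdivision.
Context {d : Order.disp_t} (X : finPOrderType d).

Local Notation mapped S f := (existT (fun S0 : scomplex => ground S0 -> X) S f).

(** The pair [p] is a variable so that its equation can be substituted, which carries [b], whose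
    type depends on [p], along with it. *)
Lemma mapped_sd {dY} (Y : finPOrderType dY) (f : Y -> X)
    (p : {S : scomplex & ground S -> X})
    (b : simplex (projT1 p) -> ground (projT1 p)) :
  (forall s, b s \in val s) -> p = mapped (SComplex (order_complex Y)) f ->
  exists2 b' : sd Y -> Y, forall s, b' s \in val s &
    mapped (sd_complex (projT1 p)) (projT2 p \o b) =
    mapped (SComplex (order_complex (sd Y))) (f \o b').
Proof. by move=> hb pE; subst p; exists b. Qed.

(* The ground types of the iterated subdivisions of C and of X are only
   propositionally equal, so complex and map are transported together. *)
Lemma mapped_sdk (C : complex X) (a : approx_family C) (k : nat) :
  C = order_complex X ->
  (forall k (s : simplex (sdk_complex k C)), a k s \in val s) ->
  exists2 f : sdk k X -> X,
    contiguity_class (order_complex (sdk k X)) (order_complex X) f (@tauk d k X) &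
    mapped (sdk_complex k C) (iotak a (k := k)) =
    mapped (SComplex (order_complex (sdk k X))) f.
Proof.
move=> CX ha; elim: k => [|k [f cf fE]].
  exists id; last by rewrite /= CX.
  by apply/contiguous_class/contiguous_refl/homo_simplicial.
have [b hb bE] := @mapped_sd _ _ f (mapped _ (iotak a (k := k))) (a k) (ha k) fE.
exists (f \o b) => //.
apply: contiguity_class_comp cf; apply: contiguous_class.
by apply: mem_simplex_contiguous => // s; have [] := tau_is_last s.
Qed.

End IteratedSubdivision.

(** * Simplicial covers expressed through the iterated last-element map *)

Section MotionCovers.
Context {d : Order.disp_t} {P : finPOrderType d} {n : nat}.

(** The condition of [SC_cover] with the complex and the map to [power n P] as parameters, so that
    either can be replaced. *)
Definition motion_cover (Y : finType) (K : complex Y) (t : Y -> power n P)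
    (r : nat) : Prop :=
  exists L : 'I_r -> complex Y,
    [/\ forall i, subcomplex (L i) K,
        \bigcup_i faces (L i) = faces K
      & forall i (j j' : 'I_n), contiguity_class (L i) (order_complex P)
          (fun y => fun_of_fin (t y) j) (fun y => fun_of_fin (t y) j')].

Lemma proj_homo (j : 'I_n) :
  {homo (fun x : power n P => fun_of_fin x j) : x y / (x <= y)%O}.
Proof. by move=> x y /forallP. Qed.

Lemma motion_cover_class (Y : finType) (K : complex Y) (t t' : Y -> power n P) r :
  contiguity_class K (order_complex (power n P)) t t' ->
  motion_cover K t r -> motion_cover K t' r.
Proof.
move=> tt' [L [LK Lcov Lcl]]; exists L; split=> // i j j'.
have ctt' l : contiguity_class (L i) (order_complex P)
    (fun y => fun_of_fin (t y) l) (fun y => fun_of_fin (t' y) l).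
  have prl := contiguous_class (contiguous_refl (homo_simplicial (@proj_homo l))).
  exact: contiguity_class_comp (contiguity_class_sub (LK i) tt') prl.
apply: contiguity_class_trans (ctt' j'); apply: contiguity_class_trans (Lcl i j j').
exact: contiguity_class_sym.
Qed.

(** Coordinate projections are monotone, hence send chains to chains. *)
Lemma ordered_productE :
  ordered_product (ordered_order_complex P) n = order_complex (power n P).
Proof.
apply: complex_inj; apply/setP => A; rewrite !inE.
case A0: (A != set0) => //=; case cA: (is_chain A) => //=.
apply/forallP => j; have := homo_simplicial (@proj_homo j) (s := A).
by apply; rewrite inE A0.
Qed.

Lemma SC_coverE (R : realType)
    (a : approx_family (ordered_product (ordered_order_complex P) n)) k r :
  approximates_id R a ->
  SC_cover a k r <-> motion_cover (order_complex (sdk k (power n P)))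
    (@tauk d k (power n P)) r.
Proof.
move=> ha; have hmem k' s : a k' s \in val s.
  exact: simplicial_approximation_mem (ha k') s.
have [f cf E] := mapped_sdk k ordered_productE hmem.
have -> : SC_cover a k r <->
    motion_cover (order_complex (sdk k (power n P))) f r.
  (* As a predicate of the pair, the cover condition is transported along [E] in a single
     rewrite. *)
  pose Psi (p : {S : scomplex & ground S -> power n P}) :=
    motion_cover (projT1 p) (projT2 p) r.
  by rewrite -[X in _ <-> X]/(Psi (existT _ (SComplex (order_complex _)) f)) -E.
split; first exact: motion_cover_class.
exact/motion_cover_class/contiguity_class_sym.
Qed.

End MotionCovers.

(** * Motion planners versus contiguity covers *)

Section CoverComparison.
Context {d : Order.disp_t} {P : finPOrderType d} {n : nat}.

(** Walks along leg [j] by level; [inord] gives the intended point only for [l <= m.+1]. *)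
Definition fan_point (m : nat) (j : 'I_n) (l : nat) : fan_poset n m.+1 :=
  if l is l'.+1 then Some (inord l', j) else None.

Lemma fan_level_point m j l : (l <= m.+1)%N -> fan_level (fan_point m j l) = l.
Proof. by case: l => //= l lm; rewrite inordK. Qed.

Lemma fan_point_end m j : fan_point m j m.+1 = fan_end m.+1 j.
Proof. by congr (Some (_, j)); apply: val_inj; rewrite /= inordK. Qed.

Lemma fan_point_le m j l : (l <= m)%N ->
  if odd l then (fan_point m j l.+1 <= fan_point m j l)%O
  else (fan_point m j l <= fan_point m j l.+1)%O.
Proof.
move=> lm; have legj l1 l2 : same_leg (fan_point m j l1) (fan_point m j l2).
  by case: l1 l2 => [|l1] [|l2] /=.
by case: ifPn => ol; apply/orP; right;
  rewrite legj !fan_level_point ?(leqW lm) //= ?negbK ol eqxx ?orbT.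
Qed.

Lemma CC_motion_cover k r :
  CC_cover n k P r ->
  motion_cover (order_complex (sdk k (power n P))) (@tauk d k (power n P)) r.
Proof.
case=> Q [oQ Qcov [[//|m] _ [s hs]]]; exists (fun i => chain_complex (Q i)); split.
- by move=> i; apply/subsetP => A; rewrite inE => /andP[].
- apply/setP => A; apply/bigcupP/idP => [[i _]|cA]; first by rewrite inE => /andP[].
  (* An open set containing the last element of a chain contains the whole chain. *)
  have [x [xA xmax]] := chain_is_last cA.
  have /bigcupP[i _ xQ] : x \in \bigcup_i Q i by rewrite Qcov inE.
  exists i => //; rewrite inE; apply/andP; split=> //.
  by apply/subsetP => y /xmax yx; apply: oQ yx xQ.
move=> i; have [/(fs_continuous_onP _ (oQ i)) smono send] := hs i.
(* Evaluations of the planner at comparable fan points are comparable monotone maps on [Q i]. *)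
have path_class (z z' : fan_poset n m.+1) : (z <= z')%O ->
    contiguity_class (chain_complex (Q i)) (order_complex P)
    (fun y => mspace_fun (s i y) z) (fun y => mspace_fun (s i y) z').
  have hmono u : {in Q i &, {homo (fun y => mspace_fun (s i y) u) : x y / (x <= y)%O}}.
    by move=> x y xQ yQ xy; have /forallP := smono x y xQ yQ xy.
  move=> zz'; apply: le_contiguity_class => // y _.
  by have /forallP/(_ z)/forallP/(_ z')/implyP := valP (s i y); apply.
have to_leg j l : (l <= m.+1)%N ->
    contiguity_class (chain_complex (Q i)) (order_complex P)
    (fun y => mspace_fun (s i y) None) (fun y => mspace_fun (s i y) (fan_point m j l)).
  elim: l => [|l IH] lm; first exact: path_class.
  apply: contiguity_class_trans (IH (ltnW lm)) _; have := @fan_point_le m j l lm.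
  case: ifP => _ le_l; last exact: path_class le_l.
  exact: contiguity_class_sym (path_class _ _ le_l).
have to_end j : contiguity_class (chain_complex (Q i)) (order_complex P)
    (fun y => mspace_fun (s i y) None) (fun y => fun_of_fin (tauk y) j).
  have [c c0 [phi [sphi phi0 phic cphi]]] := to_leg j m.+1 (leqnn _).
  exists c => //; exists phi; split=> // y yQc; rewrite phic //.
  have yQ : y \in Q i by move: yQc; rewrite !inE sub1set => /andP[].
  by rewrite -(send y yQ) ffunE fan_point_end.
by move=> j j'; apply: contiguity_class_trans (to_end j'); apply: contiguity_class_sym.
Qed.

(** A subcomplex becomes an open set only in the next subdivision, whence the level [k.+1]. A
    simplex is sent to the path whose value at each fan point is the last element of a set of images
    assigned to that point. *)
Lemma motion_CC_cover k r : (0 < n)%N ->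
  motion_cover (order_complex (sdk k (power n P))) (@tauk d k (power n P)) r ->
  CC_cover n k.+1 P r.
Proof.
case: n => // n' _ [L [LK Lcov Lcl]]; set t := @tauk d k (power n'.+1 P) in Lcl.
set Y := sdk k (power n'.+1 P) in t LK Lcov Lcl *.
(* Coordinate [ord0] is the common start: leg [j] will lead from it to coordinate [j]. *)
have padded (ij : 'I_r * 'I_n'.+1) : exists c, exists phi : nat -> Y -> P,
    [/\ {in vertices (L ij.1), phi 0 =1 (fun y => fun_of_fin (t y) ord0)},
        forall c', (c <= c')%N ->
          {in vertices (L ij.1), phi c' =1 (fun y => fun_of_fin (t y) ij.2)}
      & forall l, contiguous (L ij.1) (order_complex P) (phi l) (phi l.+1)].
  by have [c _ /contiguity_class_pad] := Lcl ij.1 ord0 ij.2; exists c.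
have [c /choice[phi phiP]] := choice padded.
(* [C] bounds all lengths, the successor keeps [m] positive, and each contiguity takes two fan
   steps. *)
pose C := (\max_ij c ij).+1; pose m := C.*2.
(* An even level [2p] carries the image under [phi p]; the odd level [2p+1] carries the union of the
   images under [phi p] and [phi p.+1], so it contains both neighbours. *)
pose V i j l (A : {set Y}) := phi (i, j) l./2 @: A :|: phi (i, j) (uphalf l) @: A.
pose leg (z : fan n'.+1 m) := if z is Some (_, j) then j else ord0.
pose W i z := V i (leg z) (fan_level z).
have V0 i j A : A \in faces (L i) -> V i j 0%N A = (fun y => fun_of_fin (t y) ord0) @: A.
  by have [phi0 _ _] := phiP (i, j); rewrite /V setUid => /(eq_imset_face phi0).
have W_face i z A : A \in faces (L i) -> W i z A \in faces (order_complex P).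
  have [_ _ cphi] := phiP (i, leg z); rewrite /W /V uphalf_half => AL.
  case: odd; rewrite ?add1n ?add0n; first exact: cphi.
  by rewrite setUid; apply: contiguous_simplicial (cphi _) _ AL.
have W_fan i z z' A : A \in faces (L i) -> (z <= z')%O -> W i z A \subset W i z' A.
  move=> AL /orP[/eqP-> // | /and4P[slz /negPf ez oz' adj]].
  (* The centre has the default leg [ord0]; by [V0] its set is the same on every leg. *)
  have -> : W i z A = V i (leg z') (fan_level z) A.
    case: z z' slz oz' {ez adj} => [[l j]|] [[l' j']|] //=; first by move=> /eqP->.
    by rewrite /W !V0.
  rewrite /W /V uphalf_half ez setUid.
  case/orP: adj => /eqP E; rewrite E in oz' ez *.
    by rewrite subsetUr.
  by rewrite /= uphalf_half ez subsetUl.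
have Vmono i j l (A B : {set Y}) : A \subset B -> V i j l A \subset V i j l B.
  by move=> AB; apply: setUSS; apply: imsetS.
pose Q i : {set sd Y} := [set x : sd Y | val x \in faces (L i)].
have oQ i : fs_open (Q i).
  move=> x y yx; rewrite !inE => xL; apply: faces_sub xL yx _.
  exact: face_neq0 (valP y).
have pathP (ix : 'I_r * sd Y) : exists g : path_space n'.+1 m P, ix.2 \in Q ix.1 ->
    forall z, is_last (W ix.1 z (val ix.2)) (mspace_fun g z).
  case: ix => i x /=; have [xQ|xQ] := boolP (x \in Q i); last first.
    (* Off [Q i] the path is an arbitrary constant one. *)
    have mconst : monotone
        ([ffun=> fun_of_fin (t (tau x)) ord0] : fpow (fan_poset n'.+1 m) P).
      by apply/'forall_forallP => z z'; rewrite !ffunE lexx implybT.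
    by exists (MSpace mconst).
  have xL : val x \in faces (L i) by rewrite inE in xQ.
  have [g gP] := choice (fun z => chain_is_last (W_face i z _ xL)).
  have mg : monotone ([ffun z => g z] : fpow (fan_poset n'.+1 m) P).
    apply/'forall_forallP => z z'; apply/implyP => zz'; rewrite !ffunE.
    exact: is_last_le (W_fan i z z' _ xL zz') (gP z) (gP z').
  by exists (MSpace mg) => _ z; rewrite ffunE.
have [g gP] := choice pathP.
exists Q; split=> //.
  apply/setP => x; rewrite inE; apply/bigcupP.
  have : val x \in \bigcup_i faces (L i) by rewrite Lcov (valP x).
  by case/bigcupP => i _ xL; exists i; rewrite ?inE.
exists m; first by rewrite double_gt0.
exists (fun i x => g (i, x)) => i; split=> [|x xQ].
  apply/(fs_continuous_onP _ (oQ i)) => x y xQ yQ xy; apply/forallP => z.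
  exact: is_last_le (Vmono _ _ _ _ _ xy) (gP (i, x) xQ z) (gP (i, y) yQ z).
apply/ffunP => j; rewrite ffunE.
have xL : val x \in faces (L i) by rewrite inE in xQ.
(* The end of leg [j] has level [C.*2], where both images are under [phi C], that is, under the
   [j]-th coordinate of [t]; being monotone, this map takes the last element [tau x] to the last
   element of the image. *)
have := gP (i, x) xQ (fan_end m j); rewrite /= /W /V /= doubleK uphalf_double.
have [_ phiC _] := phiP (i, j).
have cC : (c (i, j) <= C)%N by apply/leqW/leq_bigmax.
rewrite (eq_imset_face (phiC C cC) xL) setUid => /is_last_uniq; apply.
apply: (is_last_imset (f := fun y => fun_of_fin (t y) j)) (tau_is_last x).
by move=> y y' /tauk_homo/proj_homo.
Qed.

End CoverComparison.

Theorem theoremC (R : realType) (d : Order.disp_t) (P : finPOrderType d)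
    (hP : fs_connected P) (n : nat) (hn : (2 <= n)%N)
    (a : approx_family (ordered_product (ordered_order_complex P) n))
    (ha : approximates_id R a) :
  CC_infty n P = SC a.
Proof.
rewrite /CC_infty /SC /CC /SCk !emin_least; congr least.
apply/funext => r; apply/propext; split=> -[k].
  by move=> /CC_motion_cover h; exists k; apply/(SC_coverE k r ha).
(* The extra subdivision is absorbed by the minimum over all levels. *)
move=> /(SC_coverE k r ha) h; exists k.+1; apply: motion_CC_cover h.
exact: leq_trans hn.
Qed.
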